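(* Let $H\in\mathbb{R}^{q\times d}$ with $\mathrm{rank}(H)=q=d$, and define its condition number $$\mathcal{C}_H:=\max\{|Hu||v|:\ |u|=1,\ |Hv|=1\}.$$ Assume the kinetic energy principle: there exist $\beta_h\in(0,1)$ and $K_h>0$ such that $$|\Psi_h(u)|^2+\mathrm{tr}(R_h(u))\le(1-\beta_h)|u|^2+K_h\qquad\text{for all }u\in\mathbb{R}^d .$$ Then for all $u\in\mathbb{R}^d$ $$|H\Psi_h(u)|^2+\mathrm{tr}(HR_h(u)H^T)\le(1-\beta_h)\,\mathcal{C}_H^2\,|Hu|^2+|H|^2K_h ,$$ where $|H|$ is the operator norm. In particular, if $(1-\beta_h)\mathcal{C}_H^2<1$, then the observable energy criterion holds, i.e. there exist $\beta_h'\in(0,1)$ and $K_h'>0$ with $$|H\Psi_h(u)|^2+\mathrm{tr}(HR_h(u)H^T)\le(1-\beta_h')|Hu|^2+K_h'\qquad\text{for all }u\in\mathbb{R}^d ,$$ and therefore, for the EnKF and for the ensemble square root filters (ETKF and EAKF) described in the context, started from initial conditions with $\mathbb{E}|U_0|^2+\sum_k\mathbb{E}|V_0^{(k)}|^2<\infty$, the expected square norms $\mathbb{E}|V_n^{(k)}|^2$, $k=1,\dots,K$, are bounded uniformly in $n\ge0$.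
   Context: Signal and observations. Fix $h>0$, $d\ge1$, $K\ge2$. $\Psi_h:\mathbb{R}^d\to\mathbb{R}^d$ is a measurable map. The signal in $\mathbb{R}^d$ and observation in $\mathbb{R}^q$ are $$U_n=\Psi_h(U_{n-1})+\zeta_n,\qquad Z_n=HU_n+\xi_n .$$ Given the past up to time $n-1$, the law of $\zeta_n$ depends only on $U_{n-1}$; given $U_{n-1}=u$ it has mean $0$ and covariance matrix $R_h(u)$. The $\xi_n$ are i.i.d. with mean $0$ and covariance $I_q$, independent of everything else. Forecast step (all filters). Given $\{V_{n-1}^{(k)}\}_{k=1}^K\subset\mathbb{R}^d$, set $\widehat V_n^{(k)}=\Psi_h(V_{n-1}^{(k)})+\zeta_n^{(k)}$, where $\zeta_n^{(k)}$ has the conditional law that $\zeta_n$ has given $U_{n-1}=V_{n-1}^{(k)}$. Put $\overline{\widehat V}_n=\frac1K\sum_k\widehat V_n^{(k)}$, $\widehat S_n=[\widehat V_n^{(1)}-\overline{\widehat V}_n,\dots,\widehat V_n^{(K)}-\overline{\widehat V}_n]$, $\widehat C_n=\frac1{K-1}\widehat S_n\widehat S_n^T$. Given the past up to time $n-1$, all noises at time $n$ (including $\xi_n^{(k)}$ below) are independent. EnKF analysis: $Z_n^{(k)}=Z_n+\xi_n^{(k)}$ with $\xi_n^{(k)}$ distributed as $\xi_n$, and $V_n^{(k)}=\widehat V_n^{(k)}-\widehat C_nH^T(I+H\widehat C_nH^T)^{-1}(H\widehat V_n^{(k)}-Z_n^{(k)})$. ETKF/EAKF assimilation: $\overline V_n=\overline{\widehat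 V}_n-\widehat C_nH^T(I+H\widehat C_nH^T)^{-1}(H\overline{\widehat V}_n-Z_n)$; the posterior spread is a $d\times K$ matrix $S_n$, of the form $S_n=\widehat S_nT_n$ with $T_n\in\mathbb{R}^{K\times K}$ (ETKF) or $S_n=A_n\widehat S_n$ with $A_n\in\mathbb{R}^{d\times d}$ (EAKF), chosen measurably as a function of the forecast ensemble, whose columns sum to zero and with $\frac1{K-1}S_nS_n^T=\widehat C_n-\widehat C_nH^T(H\widehat C_nH^T+I)^{-1}H\widehat C_n$; then $V_n^{(k)}=\overline V_n+S_n^{(k)}$, with $S_n^{(k)}$ the $k$-th column of $S_n$. *)

(* Defs.v *)
From HB Require Import structures.
From mathcomp Require Import all_boot all_order all_algebra.
From mathcomp Require Import all_classical all_reals all_analysis.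

Set Implicit Arguments.
Unset Strict Implicit.
Unset Printing Implicit Defensive.
Import Order.TTheory GRing.Theory Num.Theory.
Import numFieldNormedType.Exports.
Local Open Scope classical_set_scope.
Local Open Scope ring_scope.

(* The product sigma-algebra on matrices, generated by the entries; over R it
   is the Borel sigma-algebra. *)
Definition measure_mx_display : measure_display -> measure_display.
Proof. exact. Qed.

Section measurable_mx.
Context {disp : measure_display} {T : measurableType disp} (m n : nat).

Definition mx_cylinders : set (set 'M[T]_(m, n)) :=
  \bigcup_(ij in [set: 'I_m * 'I_n])
    preimage_set_system setT (fun M : 'M[T]_(m, n) => M ij.1 ij.2) measurable.

Let mx_set0 : <<s mx_cylinders >> set0.
Proof. exact: sigma_algebra0. Qed.

Let mx_setC A : <<s mx_cylinders >> A -> <<s mx_cylinders >> (~` A).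
Proof. exact: sigma_algebraC. Qed.

Let mx_bigcup (F : (set 'M[T]_(m, n))^nat) :
  (forall i, <<s mx_cylinders >> (F i)) ->
  <<s mx_cylinders >> (\bigcup_i F i).
Proof. exact: sigma_algebra_bigcup. Qed.

HB.instance Definition _ := @isMeasurable.Build (measure_mx_display disp)
  'M[T]_(m, n) <<s mx_cylinders >> mx_set0 mx_setC mx_bigcup.

End measurable_mx.

Section euclidean.
Context {R : realType}.

(* The library norm on matrices is the max norm. *)
Definition enorm n (u : 'cV[R]_n) : R := Num.sqrt (\sum_i u i 0 ^+ 2).

Definition opnorm m n (A : 'M[R]_(m, n)) : R :=
  sup [set enorm (A *m u) | u in [set u : 'cV[R]_n | enorm u <= 1]].

Definition cond_products q d (H : 'M[R]_(q, d)) : set R :=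
  [set x | exists u v : 'cV[R]_d,
     [/\ enorm u = 1, enorm (H *m v) = 1 & x = enorm (H *m u) * enorm v]].

Definition cond_number q d (H : 'M[R]_(q, d)) : R := sup (cond_products H).

Lemma enorm_ge0 n (u : 'cV[R]_n) : 0 <= enorm u.
Proof. exact: sqrtr_ge0. Qed.

Lemma enorm_attains_max n d (A : 'M[R]_(n, d)) : (0 < d)%N ->
  exists2 u : 'cV[R]_d, enorm u = 1 &
    forall v, enorm v = 1 -> enorm (A *m v) <= enorm (A *m u).
Proof.
case: d A => // d A _.
have cont m (B : 'M[R]_(m, d.+1)) :
    continuous (fun u : 'rV[R]_d.+1 => enorm (B *m u^T)).
  move=> u; apply: (@continuous_comp _ _ _ _ (@Num.sqrt R)); last first.
    exact: sqrt_continuous.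
  apply: (@continuous_big _ _ _ _ _ _ _ _ _ _) => //=; first exact: add_continuous.
  move=> i _ x.
  have c : continuous (fun u : 'rV[R]_d.+1 => (B *m u^T) i 0).
    rewrite (_ : (fun _ => _) =
        (fun u : 'rV[R]_d.+1 => \sum_j B i j * u 0 j)); last first.
      by apply/funext => y; rewrite mxE; apply: eq_bigr => j _; rewrite mxE.
    apply: continuous_big => //=; first exact: add_continuous.
    move=> j _ y; apply: continuousM; first exact: cst_continuous.
    exact: coord_continuous.
  by apply: continuousM; exact: c.
pose S := [set u : 'rV[R]_d.+1 | enorm u^T = 1].
have S0 : S !=set0.
  exists (delta_mx 0 0); rewrite /S/= /enorm (bigD1 0)//= !mxE !eqxx expr1n.
  rewrite big1 ?addr0 ?sqrtr1// => i /negbTE i0.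
  by rewrite !mxE i0 expr0n.
have cS : compact S.
  apply: bounded_closed_compact.
    exists 1; split => // M M1 u /= uS; apply/ltW/(le_lt_trans _ M1).
    rewrite [leLHS]mx_normrE; apply: bigmax_le => // -[i j] _ /=.
    rewrite ord1 -uS /enorm -sqrtr_sqr ler_sqrt; last first.
      by apply: sumr_ge0 => k _; exact: sqr_ge0.
    rewrite (bigD1 j)//= mxE lerDl.
    by apply: sumr_ge0 => k _; exact: sqr_ge0.
  rewrite (_ : S = (fun u : 'rV[R]_d.+1 => enorm (1%:M *m u^T)) @^-1` [set 1]).
    by apply: (preimage_closed (f := fun u : 'rV[R]_d.+1 => enorm (1%:M *m u^T))) => [u _|]; [exact: cont|exact: closed_eq].
  by apply/seteqP; split => u /=; rewrite mul1mx.
have [c cS1 cmax] := EVT_max_rV S0 cS (continuous_subspaceT (@cont n A)).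
exists c^T; first by move: cS1; rewrite inE.
by move=> v v1; have := cmax v^T; rewrite inE /S/= !trmxK; apply.
Qed.

(* The supremum defining [cond_number H] is a maximum when H is invertible. *)
Lemma cond_number_max q d (H : 'M[R]_(q, d)) :
  (0 < d)%N -> \rank H = q -> q = d ->
  cond_products H (cond_number H) /\
  ubound (cond_products H) (cond_number H).
Proof.
move=> d0 rH qd; subst q.
have uH : H \in unitmx by rewrite -row_free_unit /row_free rH.
have [u u1 umax] := enorm_attains_max H d0.
have [w w1 wmax] := enorm_attains_max (invmx H) d0.
set v := invmx H *m w.
have mem : cond_products H (enorm (H *m u) * enorm v).
  by exists u, v; split => //; rewrite /v mulKVmx.
have ub : ubound (cond_products H) (enorm (H *m u) * enorm v).
  move=> _ [u' [v' [u'1 v'1 ->]]]; apply: ler_pM; rewrite ?enorm_ge0//.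
    exact: umax.
  by have := wmax _ v'1; rewrite mulKmx.
suff -> : cond_number H = enorm (H *m u) * enorm v by [].
apply/le_anti/andP; split; first by apply: ge_sup => //; exists (enorm (H *m u) * enorm v).
by apply: ub_le_sup => //; exists (enorm (H *m u) * enorm v).
Qed.
Definition has_mean_cov d (mu : {measure set 'cV[R]_d -> \bar R})
    (m : 'cV[R]_d) (C : 'M[R]_d) : Prop :=
  [/\ forall i, mu.-integrable setT (fun x => (x i 0 ^+ 2)%:E),
      forall i, (\int[mu]_x (x i 0)%:E = (m i 0)%:E)%E &
      forall i j,
        (\int[mu]_x ((x i 0 - m i 0) * (x j 0 - m j 0))%:E = (C i j)%:E)%E].

End euclidean.

Section energy.
Context {R : realType} (q d : nat).
Implicit Types (H : 'M[R]_(q, d)) (Psi : 'cV[R]_d -> 'cV[R]_d)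
  (Rh : 'cV[R]_d -> 'M[R]_d).

Definition kinetic_energy_principle Psi Rh (beta K : R) : Prop :=
  forall u, enorm (Psi u) ^+ 2 + \tr (Rh u) <= (1 - beta) * enorm u ^+ 2 + K.

Definition observable_energy_criterion H Psi Rh : Prop :=
  exists beta K : R, [/\ 0 < beta < 1, 0 < K &
    forall u, enorm (H *m Psi u) ^+ 2 + \tr (H *m Rh u *m H^T)
      <= (1 - beta) * enorm (H *m u) ^+ 2 + K].

End energy.

Section ensemble.
Context {R : realType} (d K : nat).
Implicit Type v : 'I_K -> 'cV[R]_d.

Definition ens_mx v : 'M[R]_(d, K) := \matrix_(i, k) v k i 0.

Definition ens_mean v : 'cV[R]_d := K%:R^-1 *: \sum_k v k.

Definition ens_spread v : 'M[R]_(d, K) := ens_mx (fun k => v k - ens_mean v).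

Definition spread_cov (S : 'M[R]_(d, K)) : 'M[R]_d :=
  (K.-1)%:R^-1 *: (S *m S^T).

Definition ens_cov v : 'M[R]_d := spread_cov (ens_spread v).

End ensemble.

Definition kalman_gain {R : realType} q d (H : 'M[R]_(q, d)) (C : 'M[R]_d) :
    'M[R]_(d, q) :=
  C *m H^T *m invmx (1%:M + H *m C *m H^T).

Variant sqrt_filter : Set := ETKF | EAKF.

Definition spread_update {R : realType} d K (f : sqrt_filter)
    (Shat S : 'M[R]_(d, K)) : Prop :=
  match f with
  | ETKF => exists T : 'M[R]_K, S = Shat *m T
  | EAKF => exists A : 'M[R]_d, S = A *m Shat
  end.

Section filtering.
Context {R : realType} (q d K : nat) {disp : measure_display}
  {Omega : measurableType disp} (P : probability Omega R).
Variables (H : 'M[R]_(q, d)) (Psi : 'cV[R]_d -> 'cV[R]_d)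
  (kappa : nat -> R.-pker 'cV[R]_d ~> 'cV[R]_d) (nu : probability 'cV[R]_q R).

Definition events p (X : {RV P >-> 'cV[R]_p}) : set (set Omega) :=
  preimage_set_system setT X measurable.

(* [W] are the states, [X] the noises driving them and [Y] the observation
   noises.  Noises of index 0 do not enter the dynamics; observations and
   forecasts up to time n are functions of the generators listed here. *)
Definition past (I J : finType) (W X : I -> nat -> {RV P >-> 'cV[R]_d})
    (Y : J -> nat -> {RV P >-> 'cV[R]_q}) (n : nat) : set (set Omega) :=
  <<s (\bigcup_(m in [set m | (m <= n)%N]) \bigcup_i events (W i m)) `|`
      (\bigcup_(m in [set m | (0 < m <= n)%N])
         (\bigcup_i events (X i m) `|` \bigcup_j events (Y j m))) >>.

(* Given the past up to time n, the noises at time n + 1 are independent,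
   X i having law kappa n.+1 (W i n) and Y j having law nu. *)
Definition conditional_noise_law (I J : finType)
    (W X : I -> nat -> {RV P >-> 'cV[R]_d})
    (Y : J -> nat -> {RV P >-> 'cV[R]_q}) : Prop :=
  forall (n : nat) (A : set Omega)
    (B : I -> set 'cV[R]_d) (C : J -> set 'cV[R]_q),
    past W X Y n A ->
    (forall i, measurable (B i)) -> (forall j, measurable (C j)) ->
    P (A `&` \bigcap_i (X i n.+1 @^-1` B i) `&` \bigcap_j (Y j n.+1 @^-1` C j))
    = (\int[P]_(w in A)
        ((\prod_i kappa n.+1 (W i n w) (B i)) * \prod_j nu (C j)))%E.

Definition signal_observation (U zeta : nat -> {RV P >-> 'cV[R]_d})
    (Z xi : nat -> {RV P >-> 'cV[R]_q}) : Prop :=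
  forall n w, U n.+1 w = Psi (U n w) + zeta n.+1 w /\
              Z n.+1 w = H *m U n.+1 w + xi n.+1 w.

Definition forecast (V Vhat zetaE : 'I_K -> nat -> {RV P >-> 'cV[R]_d}) : Prop :=
  forall k n w, Vhat k n.+1 w = Psi (V k n w) + zetaE k n.+1 w.

(* In the two models below, [oapp f x] adjoins the signal, at index [None], to
   the family of the ensemble members. *)
Record enkf (U zeta : nat -> {RV P >-> 'cV[R]_d})
    (Z xi : nat -> {RV P >-> 'cV[R]_q})
    (V Vhat zetaE : 'I_K -> nat -> {RV P >-> 'cV[R]_d})
    (xiE : 'I_K -> nat -> {RV P >-> 'cV[R]_q}) : Prop := Enkf {
  enkf_signal : signal_observation U zeta Z xi ;
  enkf_forecast : forecast V Vhat zetaE ;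
  enkf_noise : conditional_noise_law (oapp V U) (oapp zetaE zeta)
                 (oapp xiE xi) ;
  enkf_analysis : forall k n w,
    V k n.+1 w = Vhat k n.+1 w -
      kalman_gain H (ens_cov (fun l => Vhat l n.+1 w)) *m
        (H *m Vhat k n.+1 w - (Z n.+1 w + xiE k n.+1 w)) }.

(* [S n] maps the matrix of the forecast ensemble to the posterior spread. *)
Record esrf (f : sqrt_filter) (U zeta : nat -> {RV P >-> 'cV[R]_d})
    (Z xi : nat -> {RV P >-> 'cV[R]_q})
    (V Vhat zetaE : 'I_K -> nat -> {RV P >-> 'cV[R]_d})
    (S : nat -> {mfun 'M[R]_(d, K) >-> 'M[R]_(d, K)}) : Prop := Esrf {
  esrf_signal : signal_observation U zeta Z xi ;
  esrf_forecast : forecast V Vhat zetaE ;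
  esrf_noise : conditional_noise_law (oapp V U) (oapp zetaE zeta)
                 (fun _ : unit => xi) ;
  esrf_spread : forall n w,
    let vhat k := Vhat k n.+1 w in
    let Chat := ens_cov vhat in
    let s := S n.+1 (ens_mx vhat) in
    [/\ spread_update f (ens_spread vhat) s,
        forall i, \sum_k s i k = 0 &
        spread_cov s =
          Chat - Chat *m H^T *m invmx (H *m Chat *m H^T + 1%:M) *m H *m Chat] ;
  esrf_analysis : forall k n w,
    let vhat k := Vhat k n.+1 w in
    let vbar := ens_mean vhat in
    V k n.+1 w = vbar - kalman_gain H (ens_cov vhat) *m (H *m vbar - Z n.+1 w)
                 + col k (S n.+1 (ens_mx vhat)) }.

Definition mean_square (X : {RV P >-> 'cV[R]_d}) : \bar R :=
  'E_P[fun w => enorm (X w) ^+ 2].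

Definition finite_initial_energy (U : nat -> {RV P >-> 'cV[R]_d})
    (V : 'I_K -> nat -> {RV P >-> 'cV[R]_d}) : Prop :=
  (mean_square (U 0%N) + \sum_k mean_square (V k 0%N) < +oo)%E.

Definition bounded_mean_squares (V : 'I_K -> nat -> {RV P >-> 'cV[R]_d}) :
    Prop :=
  exists M : R, forall k n, (mean_square (V k n) <= M%:E)%E.

End filtering.

(* Main.v *)
(* Multiplying by H^-1 costs a factor at most cond_number H / opnorm H, so the
   kinetic energy principle passes from |u| to |Hu|.  The conditional noise law
   identifies the joint law of a state and its noise, and integrating the noise
   out turns the criterion for Psi into E|H Vhat|^2 <= r E|HV|^2 + c.

   With B = H Chat H^T >= 0, the observed EnKF analysis is
   (1 + B)^-1 HVhat + (1 - (1 + B)^-1) Z^(k), a convex combination with operator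
   weights, so |HV|^2 <= |HVhat|^2 + |Z^(k)|^2.  For the square root filters the
   same bound holds for the mean, while the observed spread has trace
   (K - 1) tr (B - B (1 + B)^-1 B) <= (K - 1) tr B, so that
   sum_k |HV_k|^2 <= sum_k |HVhat_k|^2 + K |Z|^2.  The signal itself obeys the
   forecast bound, hence E|Z|^2 is bounded and the total observable energy obeys
   a contracting affine recursion. *)
Require Import Defs.
From HB Require Import structures.
From mathcomp Require Import all_boot all_order all_algebra.
From mathcomp Require Import all_classical all_reals all_analysis.
From mathcomp Require Import measurable_realfun ring lra.

Set Implicit Arguments.
Unset Strict Implicit.
Unset Printing Implicit Defensive.
Import Order.TTheory GRing.Theory Num.Theory.
Import numFieldNormedType.Exports.
Local Open Scope classical_set_scope.
Local Open Scope ring_scope.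

(** * Euclidean norms and the Kalman update *)

Section euclidean.
Context {R : realType}.

Definition dot n (u v : 'cV[R]_n) : R := \sum_i u i 0 * v i 0.

Lemma enorm_sqr n (u : 'cV[R]_n) : enorm u ^+ 2 = \sum_i u i 0 ^+ 2.
Proof. by rewrite sqr_sqrtr// sumr_ge0// => i _; exact: sqr_ge0. Qed.

Lemma dotuu n (u : 'cV[R]_n) : dot u u = enorm u ^+ 2.
Proof. by rewrite enorm_sqr; apply: eq_bigr => i _; rewrite expr2. Qed.

Lemma dotC n (u v : 'cV[R]_n) : dot u v = dot v u.
Proof. by apply: eq_bigr => i _; rewrite mulrC. Qed.

Lemma dotE n (u v : 'cV[R]_n) : dot u v = (u^T *m v) 0 0.
Proof. by rewrite mxE; apply: eq_bigr => i _; rewrite mxE. Qed.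

Lemma dot_adj m n (A : 'M[R]_(m, n)) (u : 'cV[R]_m) (v : 'cV[R]_n) :
  dot u (A *m v) = dot (A^T *m u) v.
Proof. by rewrite !dotE trmx_mul trmxK mulmxA. Qed.

Lemma dotDl n (u v w : 'cV[R]_n) : dot (u + v) w = dot u w + dot v w.
Proof. by rewrite !dotE linearD/= mulmxDl mxE. Qed.

Lemma dotDr n (u v w : 'cV[R]_n) : dot u (v + w) = dot u v + dot u w.
Proof. by rewrite !dotE mulmxDr mxE. Qed.

Lemma dotBl n (u v w : 'cV[R]_n) : dot (u - v) w = dot u w - dot v w.
Proof. by rewrite !dotE linearB/= mulmxBl !mxE. Qed.

Lemma dotZr n (c : R) (u v : 'cV[R]_n) : dot u (c *: v) = c * dot u v.
Proof. by rewrite !dotE -scalemxAr mxE. Qed.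

Lemma dot0r n (u : 'cV[R]_n) : dot u 0 = 0.
Proof. by rewrite dotE mulmx0 mxE. Qed.

Lemma dotuu_ge0 n (u : 'cV[R]_n) : 0 <= dot u u.
Proof. by rewrite dotuu sqr_ge0. Qed.

Lemma enorm_eq0 n (u : 'cV[R]_n) : enorm u = 0 -> u = 0.
Proof.
move=> u0; have /eqP := enorm_sqr u; rewrite u0 expr0n/= eq_sym.
rewrite psumr_eq0; last by move=> i _; exact: sqr_ge0.
move=> /allP h; apply/matrixP => i j; rewrite ord1 mxE; apply/eqP.
by have := h i (mem_index_enum _); rewrite sqrf_eq0.
Qed.

Lemma enorm0 n : enorm (0 : 'cV[R]_n) = 0.
Proof. by rewrite /enorm big1 ?sqrtr0// => i _; rewrite mxE expr0n. Qed.

Lemma enormZ n (c : R) (u : 'cV[R]_n) : enorm (c *: u) = `|c| * enorm u.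
Proof.
rewrite /enorm -sqrtr_sqr -sqrtrM ?sqr_ge0// mulr_sumr.
by congr Num.sqrt; apply: eq_bigr => i _; rewrite mxE exprMn.
Qed.

Lemma enormD_sqr n (u v : 'cV[R]_n) :
  enorm (u + v) ^+ 2 = enorm u ^+ 2 + 2 * dot u v + enorm v ^+ 2.
Proof. rewrite -!dotuu dotDl !dotDr (dotC v u); ring. Qed.

Lemma enormD_sqr_le n (u v : 'cV[R]_n) :
  enorm (u + v) ^+ 2 <= 2 * (enorm u ^+ 2 + enorm v ^+ 2).
Proof.
have := dotuu_ge0 (u - v).
rewrite enormD_sqr -!dotuu dotBl !(dotC _ (u - v)) !dotBl (dotC v u).
lra.
Qed.

(** [sup] is only meaningful on nonempty bounded sets. The maximum of |Au| over the unit sphere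
    bounds the whole unit ball, since scaling a nonzero v of the ball up to the sphere can only
    increase |Av|. *)
Lemma opnorm_has_sup m n (A : 'M[R]_(m, n)) : (0 < n)%N ->
  has_sup [set enorm (A *m u) | u in [set u : 'cV[R]_n | enorm u <= 1]].
Proof.
move=> n0; split; first by exists (enorm (A *m 0)), 0 => //=; rewrite enorm0.
have [u u1 umax] := enorm_attains_max A n0.
exists (enorm (A *m u)) => _ [v /= v1 <-].
have [v0|v0] := eqVneq (enorm v) 0.
  by rewrite (enorm_eq0 v0) mulmx0 enorm0 enorm_ge0.
have vgt0 : 0 < enorm v by rewrite lt_neqAle eq_sym v0 enorm_ge0.
have := umax ((enorm v)^-1 *: v).
rewrite enormZ ger0_norm ?invr_ge0 ?enorm_ge0// mulVf// => /(_ erefl).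
rewrite -scalemxAr enormZ ger0_norm ?invr_ge0 ?enorm_ge0//; apply: le_trans.
by rewrite ler_peMl ?enorm_ge0// invf_ge1.
Qed.

Lemma opnorm_ge0 m n (A : 'M[R]_(m, n)) : (0 < n)%N -> 0 <= opnorm A.
Proof.
move=> n0; apply: ub_le_sup; first by have [] := opnorm_has_sup A n0.
by exists 0; rewrite /= ?mulmx0 ?enorm0.
Qed.

Lemma opnorm_le m n (A : 'M[R]_(m, n)) (u : 'cV[R]_n) : (0 < n)%N ->
  enorm (A *m u) <= opnorm A * enorm u.
Proof.
move=> n0; have [u0|u0] := eqVneq (enorm u) 0.
  by rewrite (enorm_eq0 u0) mulmx0 !enorm0 mulr0.
have ugt0 : 0 < enorm u by rewrite lt_neqAle eq_sym u0 enorm_ge0.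
have -> : enorm (A *m u) = enorm (A *m ((enorm u)^-1 *: u)) * enorm u.
  rewrite -scalemxAr enormZ ger0_norm ?invr_ge0 ?enorm_ge0//.
  by rewrite mulrAC mulVf ?mul1r.
rewrite ler_pM2r//; apply: ub_le_sup; first by have [] := opnorm_has_sup A n0.
exists ((enorm u)^-1 *: u) => //=.
by rewrite enormZ ger0_norm ?invr_ge0 ?enorm_ge0// mulVf.
Qed.

Lemma opnorm_sqr_le m n (A : 'M[R]_(m, n)) (u : 'cV[R]_n) : (0 < n)%N ->
  enorm (A *m u) ^+ 2 <= opnorm A ^+ 2 * enorm u ^+ 2.
Proof.
move=> n0; rewrite -exprMn ler_sqr ?nnegrE ?enorm_ge0 ?opnorm_le//.
by rewrite mulr_ge0 ?opnorm_ge0 ?enorm_ge0.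
Qed.

(** For |w| <= 1, the number |Hw| |u| / |Hu| is at most the member of [cond_products] given by w /
    |w| and u / |Hu|. The supremum over w then produces [opnorm H]. *)
Lemma opnorm_cond_number d (H : 'M[R]_d) (u : 'cV[R]_d) : (0 < d)%N ->
  H \in unitmx -> opnorm H * enorm u <= cond_number H * enorm (H *m u).
Proof.
move=> d0 uH; have [u0|u0] := eqVneq (enorm u) 0.
  by rewrite (enorm_eq0 u0) mulmx0 !enorm0 !mulr0.
have Hu0 : 0 < enorm (H *m u).
  rewrite lt_neqAle enorm_ge0 andbT eq_sym; apply: contra u0 => /eqP/enorm_eq0.
  by move=> /(congr1 (mulmx (invmx H))); rewrite mulKmx// mulmx0 => ->; rewrite enorm0.
have ugt0 : 0 < enorm u by rewrite lt_neqAle eq_sym u0 enorm_ge0.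
have rH : \rank H = d by apply/eqP; move: uH; rewrite -row_free_unit.
have [_ ub] := cond_number_max d0 rH erefl.
rewrite -ler_pdivlMr//; apply: ge_sup; first by have [] := opnorm_has_sup H d0.
move=> _ [w /= w1 <-]; rewrite ler_pdivlMr// -ler_pdivrMr// -mulrA.
(* Needed for w = 0, which cannot be normalised. *)
have c0 : 0 <= cond_number H.
  have [w' w'1 _] := enorm_attains_max H d0.
  apply: le_trans (ub (enorm (H *m w') * enorm ((enorm (H *m u))^-1 *: u)) _).
    by rewrite mulr_ge0 ?enorm_ge0.
  exists w', ((enorm (H *m u))^-1 *: u); split => //.
  by rewrite -scalemxAr enormZ ger0_norm ?invr_ge0 ?enorm_ge0// mulVf ?gt_eqF.
have [w0|w0] := eqVneq (enorm w) 0.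
  by rewrite (enorm_eq0 w0) mulmx0 !enorm0 mul0r.
have wgt0 : 0 < enorm w by rewrite lt_neqAle eq_sym w0 enorm_ge0.
have := ub (enorm (H *m ((enorm w)^-1 *: w)) * enorm ((enorm (H *m u))^-1 *: u)).
rewrite -scalemxAr !enormZ !ger0_norm ?invr_ge0 ?enorm_ge0//.
move=> h; have {}h : (enorm w)^-1 * enorm (H *m w) *
    ((enorm (H *m u))^-1 * enorm u) <= cond_number H.
  apply: h; exists ((enorm w)^-1 *: w), ((enorm (H *m u))^-1 *: u).
  by rewrite -!scalemxAr !enormZ !ger0_norm ?invr_ge0 ?enorm_ge0// !mulVf ?gt_eqF.
apply: le_trans h; rewrite (mulrC (enorm u)) ler_wpM2r//.
  by rewrite mulr_ge0 ?invr_ge0 ?enorm_ge0.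
by rewrite ler_peMl ?enorm_ge0// invf_ge1.
Qed.

(** * Positive semidefinite matrices and the Kalman update *)

Definition possemidef n (B : 'M[R]_n) :=
  B^T = B /\ forall x : 'cV_n, 0 <= dot x (B *m x).

(** If (1 + B) v = 0, then 0 = |v|^2 + <v, Bv> is a sum of two nonnegative terms, so v = 0. *)
Lemma possemidef_unit n (B : 'M[R]_n) :
  possemidef B -> 1%:M + B \in unitmx.
Proof.
move=> [Bs Bp]; rewrite -row_free_unit; apply: inj_row_free => v v0.
have {v0} v0 : v^T + B *m v^T = 0.
  by rewrite -[in B *m _]Bs -trmx_mul -linearD/= -[X in X + _]mulmx1 -mulmxDr v0 trmx0.
have : dot v^T (v^T + B *m v^T) = 0 by rewrite v0 dot0r.
rewrite dotDr => /eqP; rewrite paddr_eq0 ?dotuu_ge0// => /andP[/eqP + _].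
rewrite dotuu => /eqP; rewrite sqrf_eq0 => /eqP/enorm_eq0 v'0.
by rewrite -[v]trmxK v'0 trmx0.
Qed.

(* Substituting x = (1 + B) a and y = (1 + B) b reduces the bound to
   |Ba - b|^2 >= 0. *)
Lemma kalman_update_le n (B : 'M[R]_n) (x y : 'cV[R]_n) : possemidef B ->
  enorm (x - B *m invmx (1%:M + B) *m (x - y)) ^+ 2 <=
  enorm x ^+ 2 + enorm y ^+ 2.
Proof.
move=> Bpsd; have [Bs Bp] := Bpsd; have uB := possemidef_unit Bpsd.
have EB (z : 'cV_n) : (1%:M + B) *m z = z + B *m z by rewrite mulmxDl mul1mx.
set a := invmx (1%:M + B) *m x; set b := invmx (1%:M + B) *m y.
have -> : x = a + B *m a by rewrite -EB mulKVmx.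
have -> : y = b + B *m b by rewrite -EB mulKVmx.
have -> : a + B *m a - B *m invmx (1%:M + B) *m (a + B *m a - (b + B *m b)) =
    a + B *m b.
  have -> : a + B *m a - (b + B *m b) = (1%:M + B) *m (a - b).
    by rewrite EB mulmxBr opprD addrACA.
  by rewrite -mulmxA mulKmx// mulmxBr opprB addrA addrAC addrK.
have := dotuu_ge0 (B *m a - b); have := Bp a; have := Bp b.
have ab : dot (B *m a) b = dot a (B *m b) by rewrite dot_adj Bs.
rewrite !enormD_sqr -!dotuu dotBl !(dotC _ (B *m a - b)) !dotBl (dotC b (B *m a)) ab.
have := dotuu_ge0 (B *m b).
lra.
Qed.

(** With x = (1 + B) a the form equals |a|^2 + <a, Ba>. *)
Lemma possemidef_invmx n (B : 'M[R]_n) (x : 'cV[R]_n) : possemidef B ->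
  0 <= dot x (invmx (1%:M + B) *m x).
Proof.
move=> Bpsd; have [Bs Bp] := Bpsd; have uB := possemidef_unit Bpsd.
have EB (z : 'cV_n) : (1%:M + B) *m z = z + B *m z by rewrite mulmxDl mul1mx.
set a := invmx (1%:M + B) *m x.
have -> : x = a + B *m a by rewrite -EB mulKVmx.
by rewrite dotC dotDr addr_ge0 ?dotuu_ge0.
Qed.

(** By symmetry of B, the diagonal entries of B (1 + B)^-1 B are the values of the quadratic form of
    (1 + B)^-1 at the columns of B, hence nonnegative. *)
Lemma mxtrace_posterior_le n (B : 'M[R]_n) : possemidef B ->
  \tr (B - B *m invmx (1%:M + B) *m B) <= \tr B.
Proof.
move=> Bpsd; rewrite linearB/= gerDl oppr_le0; apply: sumr_ge0 => i _.
have := possemidef_invmx (col i B) Bpsd; rewrite dotE.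
by rewrite tr_col Bpsd.1 -row_mul colE !mulmxA -colE !mxE.
Qed.

Lemma mxtrace_mul_trE m n (A : 'M[R]_(m, n)) :
  \tr (A *m A^T) = \sum_k enorm (col k A) ^+ 2.
Proof.
rewrite /mxtrace (eq_bigr (fun i => \sum_k A i k ^+ 2)); last first.
  by move=> i _; rewrite mxE; apply: eq_bigr => k _; rewrite mxE expr2.
rewrite exchange_big; apply: eq_bigr => k _; rewrite enorm_sqr.
by apply: eq_bigr => i _; rewrite mxE.
Qed.

End euclidean.

(** * Second moments *)

Section measurable_vectors.
Context {R : realType}.

Lemma measurable_coord {disp} {T : measurableType disp} m n (i : 'I_m)
  (j : 'I_n) : measurable_fun setT (fun M : 'M[T]_(m, n) => M i j).
Proof.
move=> _ Y mY; rewrite setTI; apply: sub_sigma_algebra.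
by exists (i, j) => //; exists Y => //; rewrite setTI.
Qed.

Lemma measurable_enorm_sqr {disp} {T : measurableType disp} n
    (f : T -> 'cV[R]_n) :
  (forall i, measurable_fun setT (fun t => f t i 0)) ->
  measurable_fun setT (fun t => enorm (f t) ^+ 2).
Proof.
move=> mf; under eq_fun do rewrite enorm_sqr.
by apply: measurable_sum => i; exact: measurable_funX.
Qed.

Lemma measurable_mulmx_coord {disp} {T : measurableType disp} m n
    (A : 'M[R]_(m, n)) (f : T -> 'cV[R]_n) i :
  (forall i, measurable_fun setT (fun t => f t i 0)) ->
  measurable_fun setT (fun t => (A *m f t) i 0).
Proof.
move=> mf; under eq_fun do rewrite mxE.
by apply: measurable_sum => j; exact: measurable_funM.
Qed.

Lemma measurable_mfun_coord {disp} {T : measurableType disp} m n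
    (X : {mfun T >-> 'M[R]_(m, n)}) i j :
  measurable_fun setT (fun t => X t i j).
Proof. exact: measurableT_comp (measurable_coord i j) _. Qed.

End measurable_vectors.

Section moments.
Context {R : realType} {disp : measure_display} {T : measurableType disp}.
Variable mu : {measure set T -> \bar R}.
Local Open Scope ereal_scope.

(** Carrying integrability along with the value lets linearity be applied repeatedly without new
    side conditions. *)
Definition has_integral (f : T -> R) (c : R) : Prop :=
  mu.-integrable setT (EFin \o f) /\ \int[mu]_x (f x)%:E = c%:E.

Lemma has_integralD f g a b : has_integral f a -> has_integral g b ->
  has_integral (fun x => f x + g x)%R (a + b)%R.
Proof.
move=> [If fa] [Ig gb]; split; first exact: (integrableD measurableT If Ig).
under eq_integral do rewrite EFinD.
by rewrite integralD// fa gb.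
Qed.

Lemma has_integralZl k f a : has_integral f a ->
  has_integral (fun x => k * f x)%R (k * a)%R.
Proof.
move=> [If fa]; split; first exact: (integrableZl measurableT k If).
under eq_integral do rewrite EFinM.
by rewrite integralZl// fa.
Qed.

Lemma has_integral_sum (I : finType) (f : I -> T -> R) (a : I -> R) :
  (forall i, has_integral (f i) (a i)) ->
  has_integral (fun x => \sum_i f i x)%R (\sum_i a i)%R.
Proof.
move=> fa; elim: (index_enum I) => [|i s ih].
  have -> : (fun x => \sum_(i <- [::]) f i x)%R = cst 0%R.
    by apply/funext => x; rewrite big_nil.
  rewrite big_nil; split; first exact: integrable0.
  by rewrite integral0.
rewrite big_cons; have := has_integralD (fa i) ih; congr has_integral.
by apply/funext => x; rewrite big_cons.
Qed.

End moments.

Section quadratic_moments.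
Context {R : realType}.
Local Open Scope ereal_scope.

(** The product is dominated by the sum of the squares: |fg| <= f^2 + g^2. *)
Lemma le_integrable_prod disp (T : measurableType disp)
    (mu : {measure set T -> \bar R}) (f g : T -> R) :
  measurable_fun setT f -> measurable_fun setT g ->
  mu.-integrable setT (fun x => (f x ^+ 2)%:E) ->
  mu.-integrable setT (fun x => (g x ^+ 2)%:E) ->
  mu.-integrable setT (fun x => (f x * g x)%:E).
Proof.
move=> mf mg If Ig.
apply: (@le_integrable _ _ _ _ _ measurableT _
    (fun x => (f x ^+ 2)%:E + (g x ^+ 2)%:E)).
- by apply/measurable_EFinP; exact: measurable_funM.
- move=> x _; rewrite -EFinD !abse_EFin lee_fin normrM (@ger0_norm _ (_ + _)%R).
    rewrite -[(f x ^+ 2)%R]real_normK ?num_real//.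
    rewrite -[(g x ^+ 2)%R]real_normK ?num_real//.
    have := sqr_ge0 (`|f x| - `|g x|)%R; have := normr_ge0 (f x).
    by have := normr_ge0 (g x); nra.
  by rewrite addr_ge0// sqr_ge0.
- exact: integrableD.
Qed.

(** Expanding |b + Ax|^2 in coordinates gives a constant, terms linear in x that integrate to 0, and
    products x_j x_k whose integrals C_jk add up to the trace. The total mass is a hypothesis, so
    that the lemma applies both to [nu] and to the values of the kernels [kappa n]. *)
Lemma has_integral_enorm_sqr p d (mu : {measure set 'cV[R]_d -> \bar R})
    (C : 'M[R]_d) (b : 'cV[R]_p) (A : 'M[R]_(p, d)) :
  mu setT = 1 -> has_mean_cov mu 0 C ->
  has_integral mu (fun x => enorm (b + A *m x) ^+ 2)%R
    (enorm b ^+ 2 + \tr (A *m C *m A^T))%R.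
Proof.
move=> mu1 [sq mean cov].
have cst1 (c : R) : has_integral mu (fun=> c) c.
  split; last by rewrite integral_cst// [X in _ * X]mu1 mule1.
  apply/integrableP; split; first exact: measurable_cst.
  by rewrite integral_cst// [X in _ * X]mu1 mule1 ltry.
have mx i : measurable_fun setT (fun x : 'cV[R]_d => x i 0%R).
  exact: measurable_coord.
have E1 i : has_integral mu (fun x => x i 0)%R 0%R.
  split; last by rewrite mean mxE.
  (* First moments are finite because x_i = 1 * x_i is a product of two square-integrable
     functions. *)
  rewrite (_ : EFin \o _ = fun x : 'cV[R]_d => (1 * x i 0)%:E)%R; last first.
    by apply/funext => x /=; rewrite mul1r.
  apply: (@le_integrable_prod _ _ _ (fun=> 1%R)) => //.
  by rewrite expr1n; exact: (cst1 1%R).1.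
have E2 i j : has_integral mu (fun x => x i 0 * x j 0)%R (C i j).
  split; first exact: le_integrable_prod.
  by rewrite -cov; apply: eq_integral => x _; rewrite !mxE !subr0.
have := has_integralD (cst1 (enorm b ^+ 2)%R)
  (has_integral_sum (fun i => has_integralD
    (has_integral_sum (fun j => has_integralZl (2 * b i 0 * A i j)%R (E1 j)))
    (has_integral_sum (fun j => has_integral_sum
       (fun k => has_integralZl (A i j * A i k)%R (E2 j k)))))).
congr has_integral.
  apply/funext => x; rewrite !enorm_sqr -big_split/=; apply: eq_bigr => i _.
  rewrite [X in (_ = X ^+ 2)%R]mxE [X in (_ = (_ + X) ^+ 2)%R]mxE.
  rewrite sqrrD -addrA; congr (_ + (_ + _))%R.
    rewrite -mulrnAl mulr_sumr; apply: eq_bigr => j _.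
    by rewrite -mulrA mulr_natl.
  rewrite expr2 big_distrlr/=; apply: eq_bigr => j _; apply: eq_bigr => k _.
  by ring.
congr (_ + _)%R; rewrite /mxtrace; apply: eq_bigr => i _.
rewrite big1 ?add0r; last by move=> j _; rewrite mulr0.
rewrite mxE exchange_big; apply: eq_bigr => k _; rewrite mxE mulr_suml.
by apply: eq_bigr => j _; rewrite mxE; ring.
Qed.

Lemma integral_enorm_sqr p d (mu : {measure set 'cV[R]_d -> \bar R})
    (C : 'M[R]_d) (b : 'cV[R]_p) (A : 'M[R]_(p, d)) :
  mu setT = 1 -> has_mean_cov mu 0 C ->
  \int[mu]_x (enorm (b + A *m x) ^+ 2)%:E =
  (enorm b ^+ 2 + \tr (A *m C *m A^T))%:E.
Proof. by move=> mu1 /(has_integral_enorm_sqr b A mu1) []. Qed.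

End quadratic_moments.

(** Both traces are second moments, of Ax and of x, so the bound is the integral of |Ax|^2 <= |A|^2
    |x|^2; the positivity of C enters only through the measure it comes from. *)
Lemma mxtrace_cov_le {R : realType} p d (mu : {measure set 'cV[R]_d -> \bar R})
    (C : 'M[R]_d) (A : 'M[R]_(p, d)) : (0 < d)%N ->
  mu setT = 1%E -> has_mean_cov mu 0 C ->
  \tr (A *m C *m A^T) <= opnorm A ^+ 2 * \tr C.
Proof.
move=> d0 mu1 cov.
have IA := has_integral_enorm_sqr 0 A mu1 cov.
have I1 := has_integralZl (opnorm A ^+ 2)
  (has_integral_enorm_sqr 0 1%:M mu1 cov).
rewrite !enorm0 expr0n/= !add0r mul1mx trmx1 mulmx1 in IA I1.
rewrite -lee_fin -IA.2 -I1.2; apply: le_integral => //; [exact: IA.1|exact: I1.1|].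
move=> x _; rewrite lee_fin !add0r mul1mx; exact: opnorm_sqr_le.
Qed.

(** * Joint law of a state and its noise *)

Section joint_law.
Context {R : realType} {d d1 d2 : measure_display}.
Context {Omega : measurableType d} {T1 : measurableType d1}
  {T2 : measurableType d2}.
Variables (P : probability Omega R) (kappa : R.-pker T1 ~> T2).
Variables (W : {mfun Omega >-> T1}) (X : {mfun Omega >-> T2}).
Local Open Scope ereal_scope.

(* The law of (v, x) when x has law [kappa v]; the idle [unit] factor is the
   parameter required by the library composition of kernels. *)
Definition graph_kernel (p : unit * T1) : set (T1 * T2) -> \bar R :=
  fun A => kappa p.2 (xsection A p.2).

Let graph_kernel0 p : graph_kernel p set0 = 0.
Proof. by rewrite /graph_kernel xsection0 measure0. Qed.

Let graph_kernel_ge0 p A : 0 <= graph_kernel p A.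
Proof. exact: measure_ge0. Qed.

Let graph_kernel_sigma_additive p : semi_sigma_additive (graph_kernel p).
Proof.
move=> F mF tF mUF; rewrite /graph_kernel xsection_bigcup.
apply: measure_semi_sigma_additive.
- by move=> n; exact: measurable_xsection.
- exact: trivIset_xsection.
- by rewrite -xsection_bigcup; exact: measurable_xsection.
Qed.

HB.instance Definition _ p := isMeasure.Build _ _ _ (graph_kernel p)
  (graph_kernel0 p) (graph_kernel_ge0 p) (@graph_kernel_sigma_additive p).

Definition mgraph_kernel :=
  (graph_kernel : unit * T1 -> {measure set (T1 * T2) -> \bar R}).

Let measurable_graph_kernel A : measurable A ->
  measurable_fun [set: unit * T1] (mgraph_kernel ^~ A).
Proof.
move=> mA; have mkA := measurable_fun_xsection_finite_kernel kappa (mem_set mA).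
exact: measurableT_comp mkA measurable_snd.
Qed.

HB.instance Definition _ :=
  isKernel.Build _ _ _ _ _ mgraph_kernel measurable_graph_kernel.

Let graph_kernel_prob p : mgraph_kernel p setT = 1.
Proof.
by rewrite /mgraph_kernel/= /graph_kernel xsectionE preimage_setT prob_kernel.
Qed.

HB.instance Definition _ :=
  Kernel_isProbability.Build _ _ _ _ _ mgraph_kernel graph_kernel_prob.

(** The measure [graph_kernel p] is the image of [kappa p.2] under x |-> (p.2, x). *)
Lemma integral_graph_kernel p (f : T1 * T2 -> \bar R) :
  (forall z, 0 <= f z) -> measurable_fun setT f ->
  \int[mgraph_kernel p]_z f z = \int[kappa p.2]_x f (p.2, x).
Proof.
move=> f0 mf; have mp := pair1_measurable p.2 (T2 := T2).
rewrite -(ge0_integral_pushforward mp (kappa p.2) measurableT mf)//.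
apply: eq_measure_integral => A mA _.
by rewrite /mgraph_kernel/= /graph_kernel /pushforward xsectionE.
Qed.

Hypothesis law : forall A B, measurable A -> measurable B ->
  P (W @^-1` A `&` X @^-1` B) = \int[P]_(w in W @^-1` A) kappa (W w) B.

Lemma integral_joint_law (f : T1 * T2 -> \bar R) :
  (forall z, 0 <= f z) -> measurable_fun setT f ->
  \int[P]_w f (W w, X w) = \int[P]_w \int[kappa (W w)]_x f (W w, x).
Proof.
move=> f0 mf.
have mWX : measurable_fun setT (fun w => (W w, X w)).
  exact: measurable_fun_pair.
have mI : measurable_fun setT (fun v => \int[kappa v]_x f (v, x)).
  exact: measurable_fun_integral_finite_kernel.
(* The law of W, viewed as a constant kernel so that it can be composed. *)
pose lW : R.-pker unit ~> T1 :=
  kprobability (measurable_cst (distribution P W : pprobability T1 R)).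
transitivity (\int[mkcomp lW mgraph_kernel tt]_z f z); last first.
  rewrite integral_kcomp//= /lW/= /kprobability/=.
  under eq_integral do rewrite integral_graph_kernel//=.
  rewrite ge0_integral_distribution//.
  by move=> v; exact: integral_ge0.
transitivity (\int[pushforward P (fun w => (W w, X w))]_z f z).
  by rewrite ge0_integral_pushforward.
apply: eq_measure_integral => A mA _.
apply: (@measure_unique _ _ _
  [set A `*` B | A in measurable & B in measurable] (fun=> setT)) => //.
- exact: measurable_prod_measurableType.
- move=> _ _ [A1 mA1 [B1 mB1 <-]] [A2 mA2 [B2 mB2 <-]].
  exists (A1 `&` A2); first exact: measurableI.
  by exists (B1 `&` B2); [exact: measurableI|rewrite setXI].
- by move=> _; exists setT => //; exists setT => //; rewrite setXTT.
- by rewrite bigcup_const.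
- move=> _ [A1 mA1 [B1 mB1 <-]].
  rewrite /pushforward [LHS](law mA1 mB1) /mkcomp/= /kcomp/= /lW/= /kprobability/=.
  rewrite ge0_integral_distribution//; last first.
    exact: (measurableT_comp (measurable_graph_kernel (measurableX mA1 mB1))
      (measurable_pair1 tt)).
  (* The section of A1 x B1 at W w is B1 when W w lies in A1 and empty otherwise, which reproduces
     the restriction of the integral to the event W in A1. *)
  rewrite [LHS]integral_mkcond; apply: eq_integral => w _ /=.
  rewrite /graph_kernel/= patchE; case: ifPn => wA.
    by rewrite in_xsectionX//; move: wA; rewrite !inE.
  by rewrite notin_xsectionX ?measure0//; move: wA; rewrite !notin_setE.
- by move=> _; rewrite [ltLHS](probability_setT P) ltry.
Qed.

End joint_law.

(** * Analysis steps *)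

Section ensemble.
Context {R : realType} (q d K : nat).
Hypothesis K_gt1 : (1 < K)%N.

(** Up to the factor 1 / (K - 1), the quadratic form at x is |S^T H^T x|^2. *)
Lemma possemidef_spread_cov (H : 'M[R]_(q, d)) (S : 'M[R]_(d, K)) :
  possemidef (H *m spread_cov S *m H^T).
Proof.
rewrite /spread_cov; split=> [|x].
  by rewrite !trmx_mul trmxK linearZ/= trmx_mul trmxK mulmxA.
rewrite -scalemxAr -scalemxAl -scalemxAl dotZr mulr_ge0 ?invr_ge0 ?ler0n//.
have -> : H *m (S *m S^T) *m H^T *m x = H *m S *m (S^T *m (H^T *m x)).
  by rewrite !mulmxA.
by rewrite dot_adj trmx_mul -mulmxA dotuu_ge0.
Qed.

(** Decomposition into mean and variance: the cross terms cancel because the columns of S sum to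
    zero. [K_gt1] makes K - 1 invertible, which undoes the normalisation in [spread_cov]. *)
Lemma sum_enorm_sqr_spread (H : 'M[R]_(q, d)) (m : 'cV[R]_d)
    (S : 'M[R]_(d, K)) : (forall i, \sum_k S i k = 0) ->
  \sum_k enorm (H *m (m + col k S)) ^+ 2 =
  K%:R * enorm (H *m m) ^+ 2 + (K.-1)%:R * \tr (H *m spread_cov S *m H^T).
Proof.
move=> S0; under eq_bigr do rewrite mulmxDr enormD_sqr.
rewrite !big_split/= sumr_const card_ord -mulr_sumr.
have -> : \sum_k dot (H *m m) (H *m col k S) = 0.
  under eq_bigr do rewrite dotE.
  rewrite -summxE -mulmx_sumr -mulmx_sumr (_ : \sum_k col k S = 0).
    by rewrite !mulmx0 mxE.
  apply/matrixP => i j; rewrite summxE mxE -[RHS](S0 i).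
  by apply: eq_bigr => k _; rewrite mxE.
rewrite mulr0 addr0 mulr_natl; congr (_ + _).
rewrite /spread_cov -scalemxAr -scalemxAl linearZ/= mulrA divff ?mul1r; last first.
  by rewrite pnatr_eq0 -lt0n -subn1 subn_gt0.
have -> : H *m (S *m S^T) *m H^T = (H *m S) *m (H *m S)^T.
  by rewrite trmx_mul !mulmxA.
by rewrite mxtrace_mul_trE; apply: eq_bigr => k _; rewrite !colE mulmxA.
Qed.

Lemma ens_meanD_spread (v : 'I_K -> 'cV[R]_d) k :
  ens_mean v + col k (ens_spread v) = v k.
Proof.
by apply/matrixP => i j; rewrite !mxE ord1 addrC subrK.
Qed.

Lemma sum_ens_spread (v : 'I_K -> 'cV[R]_d) i : \sum_k ens_spread v i k = 0.
Proof.
under eq_bigr do rewrite !mxE.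
rewrite big_split/= sumr_const card_ord summxE -[_ *+ K]mulr_natl.
rewrite mulrN mulrA divff ?mul1r ?subrr//.
by rewrite pnatr_eq0 -lt0n ltnW.
Qed.

(** H times the gain is B (1 + B)^-1 with B = H C H^T, so this is [kalman_update_le] in observation
    space. *)
Lemma enkf_energy_le (H : 'M[R]_(q, d)) (v : 'I_K -> 'cV[R]_d) k
    (z : 'cV[R]_q) :
  enorm (H *m (v k - kalman_gain H (ens_cov v) *m (H *m v k - z))) ^+ 2 <=
  enorm (H *m v k) ^+ 2 + enorm z ^+ 2.
Proof.
rewrite mulmxBr /kalman_gain.
have := kalman_update_le (H *m v k) z (possemidef_spread_cov H (ens_spread v)).
by rewrite !mulmxA.
Qed.

Lemma esrf_energy_le (H : 'M[R]_(q, d)) (v : 'I_K -> 'cV[R]_d)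
    (s : 'M[R]_(d, K)) (z : 'cV[R]_q) :
  (forall i, \sum_k s i k = 0) ->
  spread_cov s = ens_cov v - ens_cov v *m H^T *m
    invmx (H *m ens_cov v *m H^T + 1%:M) *m H *m ens_cov v ->
  \sum_k enorm (H *m (ens_mean v -
    kalman_gain H (ens_cov v) *m (H *m ens_mean v - z) + col k s)) ^+ 2 <=
  \sum_k enorm (H *m v k) ^+ 2 + K%:R * enorm z ^+ 2.
Proof.
move=> s0 covs; rewrite sum_enorm_sqr_spread// covs.
(* The forecast members are also written as mean plus spread, so that both sides split into a mean
   part and a trace part to be compared separately. *)
rewrite -[X in _ <= X + _](eq_bigr _ (fun k _ =>
  congr1 (fun u => enorm (H *m u) ^+ 2) (ens_meanD_spread v k))).
rewrite sum_enorm_sqr_spread; last exact: sum_ens_spread.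
have Bpsd := possemidef_spread_cov H (ens_spread v).
rewrite -/(ens_cov v) in Bpsd *; set B := H *m ens_cov v *m H^T in Bpsd *.
have -> : H *m (ens_cov v - ens_cov v *m H^T *m invmx (B + 1%:M) *m H *m
    ens_cov v) *m H^T = B - B *m invmx (1%:M + B) *m B.
  by rewrite mulmxBr mulmxBl (addrC B 1%:M) /B !mulmxA.
have m1 : enorm (H *m (ens_mean v -
    kalman_gain H (ens_cov v) *m (H *m ens_mean v - z))) ^+ 2 <=
    enorm (H *m ens_mean v) ^+ 2 + enorm z ^+ 2.
  rewrite mulmxBr /kalman_gain; have := kalman_update_le (H *m ens_mean v) z Bpsd.
  by rewrite /B !mulmxA.
rewrite addrAC -mulrDr lerD// ler_wpM2l ?ler0n//.
exact: mxtrace_posterior_le.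
Qed.

End ensemble.

(** * Filters *)

Section noise.
Context {R : realType} (q d : nat) {disp : measure_display}
  {Omega : measurableType disp} (P : probability Omega R).
Variables (kappa : nat -> R.-pker 'cV[R]_d ~> 'cV[R]_d)
  (nu : probability 'cV[R]_q R).
Variables (I J : finType) (W X : I -> nat -> {RV P >-> 'cV[R]_d})
  (Y : J -> nat -> {RV P >-> 'cV[R]_q}).
Hypothesis noise : conditional_noise_law kappa nu W X Y.
Local Open Scope ereal_scope.

Lemma past_measurable i n (A : set 'cV[R]_d) : measurable A ->
  past W X Y n (W i n @^-1` A).
Proof.
move=> mA; apply: sub_sigma_algebra; left; exists n => //=.
by exists i => //; exists A => //; rewrite setTI.
Qed.

Lemma pastT n : past W X Y n setT.
Proof. by rewrite -setC0; apply: sigma_algebraC; exact: sigma_algebra0. Qed.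

(** Marginal of [conditional_noise_law]: all noises but [X i n.+1] are left unconstrained and
    contribute factors 1. This is the hypothesis [law] of [integral_joint_law]. *)
Lemma state_noise_law i n (A B : set 'cV[R]_d) :
  measurable A -> measurable B ->
  P (W i n @^-1` A `&` X i n.+1 @^-1` B) =
  \int[P]_(w in W i n @^-1` A) kappa n.+1 (W i n w) B.
Proof.
move=> mA mB; pose Bs j := if j == i then B else setT.
have mBs j : measurable (Bs j) by rewrite /Bs; case: ifP.
have := noise (@past_measurable i n A mA) mBs (fun=> @measurableT _ _).
have -> : W i n @^-1` A `&` \bigcap_j (X j n.+1 @^-1` Bs j)
    `&` \bigcap_j (Y j n.+1 @^-1` setT) = W i n @^-1` A `&` X i n.+1 @^-1` B.
  apply/seteqP; split=> w /=.
    by move=> [[wA /(_ i Logic.I)]]; rewrite /Bs eqxx.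
  move=> [wA wB]; split=> //; split=> // j _.
  by rewrite /Bs; case: eqP => // ->.
move=> ->; apply: eq_integral => w _.
rewrite [X in _ * X]big1 ?mule1; last by move=> j _; rewrite probability_setT.
rewrite (bigD1 i)//= /Bs eqxx big1 ?mule1// => j /negbTE ->.
by rewrite prob_kernel.
Qed.

(** The same marginalisation, with the trivial past event. *)
Lemma observation_noise_law j n (B : set 'cV[R]_q) : measurable B ->
  P (Y j n.+1 @^-1` B) = nu B.
Proof.
move=> mB; pose Bs k := if k == j then B else setT.
have mBs k : measurable (Bs k) by rewrite /Bs; case: ifP.
have := noise (@pastT n) (fun=> @measurableT _ _) mBs.
have -> : setT `&` \bigcap_i (X i n.+1 @^-1` setT)
    `&` \bigcap_k (Y k n.+1 @^-1` Bs k) = Y j n.+1 @^-1` B.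
  apply/seteqP; split=> w /=.
    by move=> [_ /(_ j Logic.I)]; rewrite /Bs eqxx.
  by move=> wB; split=> // k _; rewrite /Bs; case: eqP => // ->.
move=> ->; transitivity (\int[P]_(w in setT) cst (nu B) w).
  apply: eq_integral => w _; rewrite big1 ?mul1e; last first.
    by move=> i _; rewrite prob_kernel.
  rewrite (bigD1 j)//= /Bs eqxx big1 ?mule1// => k /negbTE ->.
  by rewrite probability_setT.
by rewrite integral_cst// [X in _ * X]probability_setT mule1.
Qed.

Lemma observation_noise_energy j n : has_mean_cov nu 0 1%:M ->
  \int[P]_w (enorm (Y j n.+1 w) ^+ 2)%:E = q%:R%:E.
Proof.
move=> nuE.
have := integral_enorm_sqr 0 1%:M (probability_setT nu) nuE.
rewrite enorm0 expr0n/= add0r mul1mx trmx1 mulmx1 mxtrace1 => <-.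
under [RHS]eq_integral do rewrite add0r mul1mx.
have mf : measurable_fun setT (fun x : 'cV[R]_q => (enorm x ^+ 2)%:E).
  apply/measurable_EFinP; apply: measurable_enorm_sqr => i.
  exact: measurable_coord.
transitivity (\int[distribution P (Y j n.+1)]_x (enorm x ^+ 2)%:E).
  by rewrite ge0_integral_distribution// => x; rewrite lee_fin sqr_ge0.
by apply: eq_measure_integral => B mB _; exact: observation_noise_law.
Qed.

Variables (p : nat) (H : 'M[R]_(p, d)) (Psi : {mfun 'cV[R]_d >-> 'cV[R]_d}).
Variables (Rh : 'cV[R]_d -> 'M[R]_d) (r c : R).
Hypothesis kappaE : forall n u, has_mean_cov (kappa n u) 0 (Rh u).
Hypotheses (r_ge0 : (0 <= r)%R) (c_ge0 : (0 <= c)%R).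
Hypothesis energy : forall u,
  (enorm (H *m Psi u) ^+ 2 + \tr (H *m Rh u *m H^T) <=
   r * enorm (H *m u) ^+ 2 + c)%R.

(** Given the state u, the noise has mean 0 and covariance [Rh u], so integrating it out yields
    exactly the left-hand side of [energy] at u. All integrands are nonnegative, so the inequality
    makes sense even when the integrals are infinite. *)
Lemma forecast_energy_le i n :
  \int[P]_w (enorm (H *m (Psi (W i n w) + X i n.+1 w)) ^+ 2)%:E <=
  r%:E * \int[P]_w (enorm (H *m W i n w) ^+ 2)%:E + c%:E.
Proof.
pose f (z : 'cV[R]_d * 'cV[R]_d) := (enorm (H *m (Psi z.1 + z.2)) ^+ 2)%:E.
have f0 z : 0 <= f z by rewrite lee_fin sqr_ge0.
have mf : measurable_fun setT f.
  apply/measurable_EFinP; apply: measurable_enorm_sqr => j.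
  apply: measurable_mulmx_coord => k; under eq_fun do rewrite mxE.
  apply: measurable_funD.
    exact: measurableT_comp (measurable_mfun_coord Psi k 0%R) measurable_fst.
  exact: measurableT_comp (measurable_coord k 0%R) measurable_snd.
have mg : measurable_fun setT (fun w => (enorm (H *m W i n w) ^+ 2)%:E).
  apply/measurable_EFinP; apply: measurable_enorm_sqr => j.
  apply: measurable_mulmx_coord => k; exact: measurable_mfun_coord.
have -> : c%:E = \int[P]_w (cst c%:E) w.
  by rewrite integral_cst// [X in _ * X]probability_setT mule1.
rewrite -ge0_integralZl//; last by move=> w _; rewrite lee_fin sqr_ge0.
rewrite -ge0_integralD//; last 2 first.
- by move=> w _; rewrite mule_ge0// lee_fin sqr_ge0.
- exact: measurable_funeM.
rewrite (@integral_joint_law _ _ _ _ _ _ _ P (kappa n.+1) (W i n) (X i n.+1)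
  (@state_noise_law i n) f)//.
have mI : measurable_fun setT (fun v => \int[kappa n.+1 v]_x f (v, x)).
  exact: measurable_fun_integral_finite_kernel.
apply: ge0_le_integral => //.
- by move=> w _; exact: integral_ge0.
- exact: measurableT_comp mI _.
- by apply: emeasurable_funD => //; exact: measurable_funeM.
move=> w _ /=; rewrite /f/=; under eq_integral do rewrite mulmxDr.
rewrite (integral_enorm_sqr _ _ (prob_kernel _) (kappaE _ _)).
by rewrite -EFinM -EFinD lee_fin.
Qed.

End noise.

(** The bound a_0 + c / (1 - r) propagates: c / (1 - r) is the fixed point of x |-> r x + c, and the
    excess a_0 is multiplied by r <= 1. *)
Lemma affine_recursion_bounded {R : realType} (a : nat -> \bar R) (r c : R) :
  0 <= r < 1 -> 0 <= c -> (forall n, (0 <= a n)%E) -> (a 0%N < +oo)%E ->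
  (forall n, (a n.+1 <= r%:E * a n + c%:E)%E) ->
  exists2 M : R, 0 <= M & forall n, (a n <= M%:E)%E.
Proof.
move=> /andP[r0 r1] c0 a0 aoo step.
have cr0 : 0 <= c / (1 - r) by rewrite divr_ge0// subr_ge0 ltW.
have fa0 : (a 0%N)%E = (fine (a 0%N))%:E by rewrite fineK// ge0_fin_numE.
have fa0_ge0 : 0 <= fine (a 0%N) by exact: fine_ge0.
exists (fine (a 0%N) + c / (1 - r)); first exact: addr_ge0.
elim=> [|n ih]; first by rewrite {1}fa0 lee_fin lerDl.
apply: (le_trans (step n)); apply: (@le_trans _ _
    (r%:E * (fine (a 0%N) + c / (1 - r))%:E + c%:E)%E).
  by apply: leeD => //; exact: lee_pmul.
rewrite -EFinM -EFinD lee_fin mulrDr -addrA lerD ?ler_piMl ?(ltW r1)//.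
have -> : r * (c / (1 - r)) + c = c / (1 - r) by field; rewrite subr_eq0 gt_eqF.
by [].
Qed.

(** * Inequalities between integrals *)

Section integral_bounds.
Context {R : realType} {disp : measure_display} {T : measurableType disp}.
Variable mu : {measure set T -> \bar R}.
Local Open Scope ereal_scope.

Lemma integral_le_add (f g h : T -> R) (a b : \bar R) :
  measurable_fun setT f -> measurable_fun setT g -> measurable_fun setT h ->
  (forall x, 0 <= f x)%R -> (forall x, 0 <= g x)%R -> (forall x, 0 <= h x)%R ->
  (forall x, f x <= g x + h x)%R ->
  \int[mu]_x (g x)%:E <= a -> \int[mu]_x (h x)%:E <= b ->
  \int[mu]_x (f x)%:E <= a + b.
Proof.
move=> /measurable_EFinP mf /measurable_EFinP mg /measurable_EFinP mh.
move=> f0 g0 h0 fgh ga hb; apply: le_trans (leeD ga hb).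
rewrite -ge0_integralD//; last 2 first.
- by move=> x _; rewrite lee_fin.
- by move=> x _; rewrite lee_fin.
apply: ge0_le_integral => //.
- by move=> x _; rewrite lee_fin.
- exact: emeasurable_funD.
- by move=> x _; rewrite -EFinD lee_fin.
Qed.

Lemma integral_le_scale (f g : T -> R) (k : R) (a : \bar R) :
  measurable_fun setT f -> measurable_fun setT g -> (0 <= k)%R ->
  (forall x, 0 <= f x)%R -> (forall x, 0 <= g x)%R ->
  (forall x, f x <= k * g x)%R ->
  \int[mu]_x (g x)%:E <= a -> \int[mu]_x (f x)%:E <= k%:E * a.
Proof.
move=> /measurable_EFinP mf /measurable_EFinP mg k0 f0 g0 fg ga.
apply: (@le_trans _ _ (k%:E * \int[mu]_x (g x)%:E)); last first.
  by apply: lee_wpmul2l.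
rewrite -ge0_integralZl//; last by move=> x _; rewrite lee_fin.
apply: ge0_le_integral => //.
- by move=> x _; rewrite lee_fin.
- exact: measurable_funeM.
- by move=> x _; rewrite -EFinM lee_fin.
Qed.

Lemma measurable_mulmx_enorm_sqr m n (A : 'M[R]_(m, n))
    (X : {mfun T >-> 'cV[R]_n}) :
  measurable_fun setT (fun x => enorm (A *m X x) ^+ 2)%R.
Proof.
apply: measurable_enorm_sqr => i; apply: measurable_mulmx_coord => j.
exact: measurable_mfun_coord.
Qed.

Lemma measurable_mfun_enorm_sqr n (X : {mfun T >-> 'cV[R]_n}) :
  measurable_fun setT (fun x => enorm (X x) ^+ 2)%R.
Proof. by apply: measurable_enorm_sqr => i; exact: measurable_mfun_coord. Qed.

(** The cross term is absorbed by |x + y|^2 <= 2 |x|^2 + 2 |y|^2; the factor 2 will only affect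
    additive constants, never the contraction rate. *)
Lemma integral_enorm_sqrD_le n (X Y : T -> 'cV[R]_n) (a b : R) :
  (forall i, measurable_fun setT (fun x => X x i 0%R)) ->
  (forall i, measurable_fun setT (fun x => Y x i 0%R)) ->
  \int[mu]_x (enorm (X x) ^+ 2)%:E <= a%:E ->
  \int[mu]_x (enorm (Y x) ^+ 2)%:E <= b%:E ->
  \int[mu]_x (enorm (X x + Y x) ^+ 2)%:E <= (2 * a + 2 * b)%:E.
Proof.
move=> mX mY Xa Yb.
have double (V : T -> 'cV[R]_n) e :
    (forall i, measurable_fun setT (fun x => V x i 0%R)) ->
    \int[mu]_x (enorm (V x) ^+ 2)%:E <= e%:E ->
    \int[mu]_x (2 * enorm (V x) ^+ 2)%:E <= (2 * e)%:E.
  move=> mV; rewrite EFinM; apply: integral_le_scale => //.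
  - by apply: measurable_funM => //; exact: measurable_enorm_sqr.
  - exact: measurable_enorm_sqr.
  - by move=> x; rewrite mulr_ge0// sqr_ge0.
  - by move=> x; rewrite sqr_ge0.
rewrite EFinD; apply: integral_le_add (double X a mX Xa) (double Y b mY Yb).
- apply: measurable_enorm_sqr => i; under eq_fun do rewrite mxE.
  exact: measurable_funD.
- by apply: measurable_funM => //; exact: measurable_enorm_sqr.
- by apply: measurable_funM => //; exact: measurable_enorm_sqr.
- by move=> x; rewrite sqr_ge0.
- by move=> x; rewrite mulr_ge0// sqr_ge0.
- by move=> x; rewrite mulr_ge0// sqr_ge0.
- by move=> x; rewrite -mulrDr enormD_sqr_le.
Qed.

End integral_bounds.

(** * Uniform bounds on the observable energy *)

Section filters.
Context {R : realType} (q d K : nat) {disp : measure_display}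
  {Omega : measurableType disp} (P : probability Omega R).
Variables (H : 'M[R]_(q, d)) (Psi : {mfun 'cV[R]_d >-> 'cV[R]_d})
  (kappa : nat -> R.-pker 'cV[R]_d ~> 'cV[R]_d) (nu : probability 'cV[R]_q R)
  (Rh : 'cV[R]_d -> 'M[R]_d) (r c : R).
Hypothesis K_gt1 : (1 < K)%N.
Hypothesis kappaE : forall n u, has_mean_cov (kappa n u) 0 (Rh u).
Hypothesis nuE : has_mean_cov nu 0 1%:M.
Hypotheses (r01 : 0 <= r < 1) (c_ge0 : 0 <= c).
Hypothesis energy : forall u,
  enorm (H *m Psi u) ^+ 2 + \tr (H *m Rh u *m H^T) <=
  r * enorm (H *m u) ^+ 2 + c.
Local Open Scope ereal_scope.

Definition observable_energy (X : {RV P >-> 'cV[R]_d}) : \bar R :=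
  \int[P]_w (enorm (H *m X w) ^+ 2)%:E.

Lemma observable_energy_ge0 X : 0 <= observable_energy X.
Proof. by apply: integral_ge0 => w _; rewrite lee_fin sqr_ge0. Qed.

Section observation.
Variables (I J : finType) (W X : I -> nat -> {RV P >-> 'cV[R]_d})
  (Y : J -> nat -> {RV P >-> 'cV[R]_q}).
Hypothesis noise : conditional_noise_law kappa nu W X Y.

Lemma forecast_observable_energy i n (What : {RV P >-> 'cV[R]_d}) :
  (forall w, What w = Psi (W i n w) + X i n.+1 w)%R ->
  observable_energy What <= r%:E * observable_energy (W i n) + c%:E.
Proof.
move=> WhatE; have /andP[r0 _] := r01.
rewrite {1}/observable_energy; under eq_integral do rewrite WhatE.
exact: (forecast_energy_le noise kappaE r0 c_ge0 energy).
Qed.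

Lemma observation_energy_bounded i j (Z : nat -> {RV P >-> 'cV[R]_q}) :
  (forall n w, W i n.+1 w = Psi (W i n w) + X i n.+1 w)%R ->
  (forall n w, Z n.+1 w = H *m W i n.+1 w + Y j n.+1 w)%R ->
  observable_energy (W i 0%N) < +oo ->
  exists2 M : R, (0 <= M)%R &
    forall n, \int[P]_w (enorm (Z n.+1 w) ^+ 2)%:E <= M%:E.
Proof.
move=> WE ZE W0.
have [M M0 WM] := affine_recursion_bounded r01 c_ge0
  (fun n => observable_energy_ge0 (W i n)) W0
  (fun n => forecast_observable_energy (WE n)).
(* M bounds the observable energy of the signal, and q is the trace of the covariance of the
   observation noise. *)
exists (2 * M + 2 * q%:R)%R; first by rewrite addr_ge0 ?mulr_ge0.
move=> n; under eq_integral do rewrite ZE.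
apply: integral_enorm_sqrD_le => //.
- move=> k; apply: measurable_mulmx_coord => l; exact: measurable_mfun_coord.
- by move=> k; exact: measurable_mfun_coord.
- exact: WM.
- by rewrite (observation_noise_energy noise).
Qed.

End observation.

(** The recursion is run on the sum over the ensemble, because the square root filters control only
    the total energy in the analysis step. One cycle adds K c from the forecasts and b from the
    analysis. *)
Lemma sum_observable_energy_bounded
    (V Vhat : 'I_K -> nat -> {RV P >-> 'cV[R]_d}) (b : R) : (0 <= b)%R ->
  (forall k n, observable_energy (Vhat k n.+1) <=
     r%:E * observable_energy (V k n) + c%:E) ->
  (forall n, \sum_k observable_energy (V k n.+1) <=
     \sum_k observable_energy (Vhat k n.+1) + b%:E) ->
  (forall k, observable_energy (V k 0%N) < +oo) ->
  exists M : R, forall k n, observable_energy (V k n) <= M%:E.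
Proof.
move=> b0 forecast analysis V0; have /andP[r0 _] := r01.
have [||n|||M _ VM] := @affine_recursion_bounded R
  (fun n => \sum_k observable_energy (V k n)) r (\sum_(k < K) c + b).
- exact: r01.
- by rewrite addr_ge0// sumr_ge0.
- by apply: sume_ge0 => k _; exact: observable_energy_ge0.
- by apply: lte_sum_pinfty => k _; exact: V0.
- move=> n; apply: le_trans (analysis n) _.
  rewrite EFinD addeA leeD2r// -sumEFin ge0_sume_distrr; last first.
    by move=> k _; exact: observable_energy_ge0.
  by rewrite -big_split/=; apply: lee_sum => k _; exact: forecast.
exists M => k n; apply: le_trans (VM n); rewrite (bigD1 k)//= leeDl//.
by apply: sume_ge0 => l _; exact: observable_energy_ge0.
Qed.

Lemma enkf_observable_energy_bounded (U zeta : nat -> {RV P >-> 'cV[R]_d})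
    (Z xi : nat -> {RV P >-> 'cV[R]_q})
    (V Vhat zetaE : 'I_K -> nat -> {RV P >-> 'cV[R]_d})
    (xiE : 'I_K -> nat -> {RV P >-> 'cV[R]_q}) :
  enkf H Psi kappa nu U zeta Z xi V Vhat zetaE xiE ->
  observable_energy (U 0%N) < +oo ->
  (forall k, observable_energy (V k 0%N) < +oo) ->
  exists M : R, forall k n, observable_energy (V k n) <= M%:E.
Proof.
move=> [sig fore noise analysis] U0 V0.
have [MZ MZ0 ZM] : exists2 M : R, (0 <= M)%R &
    forall n, \int[P]_w (enorm (Z n.+1 w) ^+ 2)%:E <= M%:E.
  (* [None] selects the signal and its observation noise; the ensemble members are the indices
     [Some k]. *)
  by apply: (observation_energy_bounded noise (i := None) (j := None)) => //
    n w; have [] := sig n w.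
(* Bound on the second moment of the perturbed observation Z + xi^(k). *)
pose b := (2 * MZ + 2 * q%:R)%R.
have b0 : (0 <= b)%R by rewrite addr_ge0 ?mulr_ge0.
apply: (@sum_observable_energy_bounded V Vhat (\sum_(k < K) b)%R) => //.
- by rewrite sumr_ge0.
- move=> k n; apply: (forecast_observable_energy noise (i := Some k)) => w.
  exact: fore.
move=> n; rewrite -sumEFin -big_split/=; apply: lee_sum => k _.
apply: (@integral_le_add _ _ _ _ _ _
    (fun w => enorm (Z n.+1 w + xiE k n.+1 w) ^+ 2)%R) (lexx _) _.
- exact: measurable_mulmx_enorm_sqr.
- exact: measurable_mulmx_enorm_sqr.
- apply: measurable_enorm_sqr => i; under eq_fun do rewrite mxE.
  by apply: measurable_funD; exact: measurable_mfun_coord.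
- by move=> w; rewrite sqr_ge0.
- by move=> w; rewrite sqr_ge0.
- by move=> w; rewrite sqr_ge0.
- by move=> w; rewrite analysis; exact: (enkf_energy_le H (fun l => Vhat l n.+1 w)).
apply: integral_enorm_sqrD_le => //.
- by move=> i; exact: measurable_mfun_coord.
- by move=> i; exact: measurable_mfun_coord.
- by rewrite (observation_noise_energy noise (Some k)).
Qed.

Lemma esrf_observable_energy_bounded f (U zeta : nat -> {RV P >-> 'cV[R]_d})
    (Z xi : nat -> {RV P >-> 'cV[R]_q})
    (V Vhat zetaE : 'I_K -> nat -> {RV P >-> 'cV[R]_d})
    (S : nat -> {mfun 'M[R]_(d, K) >-> 'M[R]_(d, K)}) :
  esrf H Psi kappa nu f U zeta Z xi V Vhat zetaE S ->
  observable_energy (U 0%N) < +oo ->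
  (forall k, observable_energy (V k 0%N) < +oo) ->
  exists M : R, forall k n, observable_energy (V k n) <= M%:E.
Proof.
move=> [sig fore noise spread analysis] U0 V0.
have [MZ MZ0 ZM] : exists2 M : R, (0 <= M)%R &
    forall n, \int[P]_w (enorm (Z n.+1 w) ^+ 2)%:E <= M%:E.
  by apply: (observation_energy_bounded noise (i := None) (j := tt)) => //
    n w; have [] := sig n w.
apply: (@sum_observable_energy_bounded V Vhat (K%:R * MZ)%R) => //.
- by rewrite mulr_ge0.
- move=> k n; apply: (forecast_observable_energy noise (i := Some k)) => w.
  exact: fore.
(* The sum moves inside the integral, since [esrf_energy_le] is a pathwise bound on the sum. *)
have sumE (X : 'I_K -> {RV P >-> 'cV[R]_d}) : \sum_k observable_energy (X k) =
    \int[P]_w (\sum_k enorm (H *m X k w) ^+ 2)%:E.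
  under [RHS]eq_integral do rewrite -sumEFin.
  rewrite ge0_integral_sum// => [k|k w _]; last by rewrite lee_fin sqr_ge0.
  by apply/measurable_EFinP; exact: measurable_mulmx_enorm_sqr.
have msum (X : 'I_K -> {RV P >-> 'cV[R]_d}) :
    measurable_fun setT (fun w => \sum_k enorm (H *m X k w) ^+ 2)%R.
  by apply: measurable_sum => k; exact: measurable_mulmx_enorm_sqr.
move=> n; rewrite !sumE.
apply: (@integral_le_add _ _ _ _ _ _
    (fun w => K%:R * enorm (Z n.+1 w) ^+ 2)%R) (lexx _) _ => //.
- by apply: measurable_funM => //; exact: measurable_mfun_enorm_sqr.
- by move=> w; apply: sumr_ge0 => k _; rewrite sqr_ge0.
- by move=> w; apply: sumr_ge0 => k _; rewrite sqr_ge0.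
- by move=> w; rewrite mulr_ge0// sqr_ge0.
- move=> w; under eq_bigr do rewrite analysis.
  by have [_ s0 covs] := spread n w; exact: esrf_energy_le.
rewrite EFinM; apply: integral_le_scale (ZM n) => //.
- by apply: measurable_funM => //; exact: measurable_mfun_enorm_sqr.
- exact: measurable_mfun_enorm_sqr.
- by move=> w; rewrite mulr_ge0// sqr_ge0.
- by move=> w; rewrite sqr_ge0.
Qed.

End filters.

(** * Comparison of mean squares and observable energies *)

Section mean_square.
Context {R : realType} (d : nat) {disp : measure_display}
  {Omega : measurableType disp} (P : probability Omega R).
Variable H : 'M[R]_d.
Hypothesis d_gt0 : (0 < d)%N.
Local Open Scope ereal_scope.

Lemma mean_squareE (X : {RV P >-> 'cV[R]_d}) :
  mean_square X = \int[P]_w (enorm (X w) ^+ 2)%:E.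
Proof. by rewrite /mean_square unlock. Qed.

Lemma observable_energy_le_mean_square (X : {RV P >-> 'cV[R]_d}) :
  observable_energy H X <= (opnorm H ^+ 2)%:E * mean_square X.
Proof.
rewrite mean_squareE; apply: integral_le_scale (lexx _).
- exact: measurable_mulmx_enorm_sqr.
- exact: measurable_mfun_enorm_sqr.
- exact: sqr_ge0.
- by move=> w; exact: sqr_ge0.
- by move=> w; exact: sqr_ge0.
- by move=> w; exact: opnorm_sqr_le.
Qed.

Lemma mean_square_le_observable_energy (X : {RV P >-> 'cV[R]_d}) :
  H \in unitmx ->
  mean_square X <= (opnorm (invmx H) ^+ 2)%:E * observable_energy H X.
Proof.
move=> uH; rewrite mean_squareE; apply: integral_le_scale (lexx _).
- exact: measurable_mfun_enorm_sqr.
- exact: measurable_mulmx_enorm_sqr.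
- exact: sqr_ge0.
- by move=> w; exact: sqr_ge0.
- by move=> w; exact: sqr_ge0.
- by move=> w; rewrite -{1}(mulKmx uH (X w)) opnorm_sqr_le.
Qed.

Lemma finite_initial_observable_energy K (U : nat -> {RV P >-> 'cV[R]_d})
    (V : 'I_K -> nat -> {RV P >-> 'cV[R]_d}) : finite_initial_energy U V ->
  observable_energy H (U 0%N) < +oo /\
  forall k, observable_energy H (V k 0%N) < +oo.
Proof.
have ms0 (X : {RV P >-> 'cV[R]_d}) : 0 <= mean_square X.
  by rewrite mean_squareE; apply: integral_ge0 => w _; rewrite lee_fin sqr_ge0.
have fin (X : {RV P >-> 'cV[R]_d}) :
    mean_square X < +oo -> observable_energy H X < +oo.
  move=> Xoo; apply: le_lt_trans (observable_energy_le_mean_square X) _.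
  by rewrite lte_mul_pinfty// lee_fin sqr_ge0.
rewrite /finite_initial_energy => UV; split=> [|k]; apply: fin.
  by apply: le_lt_trans UV; rewrite leeDl// sume_ge0.
apply: le_lt_trans UV; rewrite (bigD1 k)//= addeCA leeDl// adde_ge0//.
by rewrite sume_ge0.
Qed.

Lemma bounded_mean_squaresP K (V : 'I_K -> nat -> {RV P >-> 'cV[R]_d}) :
  H \in unitmx ->
  (exists M : R, forall k n, observable_energy H (V k n) <= M%:E) ->
  bounded_mean_squares V.
Proof.
move=> uH [M VM]; exists (opnorm (invmx H) ^+ 2 * M)%R => k n.
apply: le_trans (mean_square_le_observable_energy _ uH) _.
by rewrite (EFinM _ M); apply: lee_wpmul2l; rewrite ?lee_fin ?sqr_ge0//; exact: VM.
Qed.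

End mean_square.

(** * From the kinetic energy principle to the filters *)

Theorem theorem4p1 (R : realType) (q d K : nat)
    (d_gt0 : (1 <= d)%N) (K_gt1 : (2 <= K)%N)
    (H : 'M[R]_(q, d)) (rankH : \rank H = q) (qd : q = d)
    (Psi : {mfun 'cV[R]_d >-> 'cV[R]_d})
    (kappa : nat -> R.-pker 'cV[R]_d ~> 'cV[R]_d) (Rh : 'cV[R]_d -> 'M[R]_d)
    (kappaE : forall n u, has_mean_cov (kappa n u) 0 (Rh u))
    (nu : probability 'cV[R]_q R) (nuE : has_mean_cov nu 0 1%:M)
    (beta Kh : R) (beta01 : 0 < beta < 1) (Kh_gt0 : 0 < Kh)
    (kep : kinetic_energy_principle Psi Rh beta Kh) :
  (forall u : 'cV[R]_d,
     enorm (H *m Psi u) ^+ 2 + \tr (H *m Rh u *m H^T)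
     <= (1 - beta) * cond_number H ^+ 2 * enorm (H *m u) ^+ 2
        + opnorm H ^+ 2 * Kh)
  /\
  ((1 - beta) * cond_number H ^+ 2 < 1 ->
   [/\ observable_energy_criterion H Psi Rh,
       (forall (disp : measure_display) (Omega : measurableType disp)
          (P : probability Omega R)
          (U zeta : nat -> {RV P >-> 'cV[R]_d})
          (Z xi : nat -> {RV P >-> 'cV[R]_q})
          (V Vhat zetaE : 'I_K -> nat -> {RV P >-> 'cV[R]_d})
          (xiE : 'I_K -> nat -> {RV P >-> 'cV[R]_q}),
          enkf H Psi kappa nu U zeta Z xi V Vhat zetaE xiE ->
          finite_initial_energy U V -> bounded_mean_squares V) &
       (forall (f : sqrt_filter)
          (disp : measure_display) (Omega : measurableType disp)
          (P : probability Omega R)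
          (U zeta : nat -> {RV P >-> 'cV[R]_d})
          (Z xi : nat -> {RV P >-> 'cV[R]_q})
          (V Vhat zetaE : 'I_K -> nat -> {RV P >-> 'cV[R]_d})
          (S : nat -> {mfun 'M[R]_(d, K) >-> 'M[R]_(d, K)}),
          esrf H Psi kappa nu f U zeta Z xi V Vhat zetaE S ->
          finite_initial_energy U V -> bounded_mean_squares V)]).
Proof.
subst q; have uH : H \in unitmx by rewrite -row_free_unit /row_free rankH.
have /andP[beta0 beta1] := beta01.
set r := (1 - beta) * cond_number H ^+ 2; set c := opnorm H ^+ 2 * Kh.
have energy u : enorm (H *m Psi u) ^+ 2 + \tr (H *m Rh u *m H^T) <=
    r * enorm (H *m u) ^+ 2 + c.
  (* Pull |H|^2 out of both terms on the left, apply the kinetic energy principle, then absorb |H|^2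
     |u|^2 into C_H^2 |Hu|^2. *)
  apply: (@le_trans _ _ (opnorm H ^+ 2 * ((1 - beta) * enorm u ^+ 2 + Kh))).
    apply: (@le_trans _ _ (opnorm H ^+ 2 * (enorm (Psi u) ^+ 2 + \tr (Rh u)))).
      rewrite mulrDr lerD ?opnorm_sqr_le//.
      (* Any time index would do, as every [kappa n u] has covariance [Rh u]. *)
      exact: mxtrace_cov_le (prob_kernel (s := kappa 0%N) u) (kappaE 0 u).
    by rewrite ler_wpM2l ?sqr_ge0.
  rewrite mulrDr lerD// mulrCA /r -mulrA ler_wpM2l ?subr_ge0 ?(ltW beta1)//.
  have Hu := opnorm_cond_number u d_gt0 uH.
  rewrite -!exprMn ler_sqr ?nnegrE//.
    by rewrite mulr_ge0 ?opnorm_ge0 ?enorm_ge0.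
  by apply: le_trans Hu; rewrite mulr_ge0 ?opnorm_ge0 ?enorm_ge0.
split=> // r1.
(* A unit vector shows that |H| and C_H are positive. Hence r > 0 and c > 0, so that beta' = 1 - r
   is strictly below 1 and K_h' = c is positive. *)
have [u u1 _] := enorm_attains_max H d_gt0.
have opH0 : 0 < opnorm H.
  rewrite lt_neqAle opnorm_ge0// andbT; apply/eqP => H0.
  have := opnorm_le H u d_gt0; rewrite -H0 mul0r => Hu0.
  have /enorm_eq0 : enorm (H *m u) = 0 by apply/le_anti; rewrite Hu0 enorm_ge0.
  move=> /(congr1 (mulmx (invmx H))); rewrite mulKmx// mulmx0 => u0.
  by move: u1; rewrite u0 enorm0 => /esym/eqP; rewrite oner_eq0.
have cond0 : 0 < cond_number H.
  rewrite ltNge; apply/negP => H0; have := opnorm_cond_number u d_gt0 uH.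
  rewrite u1 mulr1 leNgt => /negP; apply; apply: le_lt_trans opH0.
  by rewrite mulr_le0_ge0 ?enorm_ge0.
have r0 : 0 < r by rewrite mulr_gt0 ?subr_gt0// exprn_gt0.
have c0 : 0 < c by rewrite mulr_gt0// exprn_gt0.
have r01 : 0 <= r < 1 by rewrite (ltW r0).
split.
- exists (1 - r), c; split=> [|//|v]; last by rewrite subKr.
  by rewrite subr_gt0 r1 gtrBl.
- move=> disp Omega P U zeta Z xi V Vhat zetaE xiE filter.
  move=> /(finite_initial_observable_energy H d_gt0)[U0 V0].
  apply: (bounded_mean_squaresP d_gt0 uH).
  exact: (enkf_observable_energy_bounded kappaE nuE r01 (ltW c0) energy filter).
- move=> f disp Omega P U zeta Z xi V Vhat zetaE S filter.
  move=> /(finite_initial_observable_energy H d_gt0)[U0 V0].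
  apply: (bounded_mean_squaresP d_gt0 uH).
  exact: (esrf_observable_energy_bounded K_gt1 kappaE nuE r01 (ltW c0) energy
    filter).
Qed.
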